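(* Let $k^\circ\subset k$ be a field extension, let $q\in k\setminus k^\circ$ be transcendental over $k^\circ$, and let $R=k^\circ[q,q^{-1}]\subset k$. Let $\phi:A\to B$ be a homomorphism of $R$-algebras, and $I$ an ideal of $A$ contained in $\ker\phi$. Assume that $B$ is a torsionfree $R$-module, and suppose that there exist $R$-module decompositions $$I=\bigoplus_{j\in J}I_j,\qquad A=\bigoplus_{j\in J}A_j,\qquad B=\bigoplus_{j\in J}B_j$$ such that $A_j$ is finitely generated (as an $R$-module), $I_j\subseteq A_j$, and $\phi(A_j)\subseteq B_j$ for all $j\in J$. If $\ker\overline{\phi}$ equals the image of $\overline{I}$ (in $\overline{A}$), then the kernel of the $k$-algebra homomorphism $\mathrm{id}\otimes\phi:k\otimes_R A\to k\otimes_R B$ equals the image of $k\otimes_R I$ (in $k\otimes_R A$).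
   Context: The field $k$ may have arbitrary characteristic and need not be algebraically closed. Since $q$ is transcendental over $k^\circ$, $R=k^\circ[q,q^{-1}]$ is a Laurent polynomial ring, and $k$ is an $R$-module via the inclusion $R\subset k$. $R$-algebras are associative and unital but not necessarily commutative; ideals are two-sided. Overbars denote reduction modulo $q-1$: for an $R$-module $A$, $\overline{A}=A/(q-1)A$, and for an $R$-module homomorphism $\phi:A\to B$, $\overline{\phi}:\overline{A}\to\overline{B}$ is the induced map. The image of $\overline{I}$ in $\overline{A}$, and of $k\otimes_R I$ in $k\otimes_R A$, are under the maps induced by the inclusion $I\subseteq A$. *)

(* Defs.v *)
From HB Require Import structures.
From mathcomp Require Import all_boot all_algebra.
From mathcomp Require Import generic_quotient ring_quotient.
From mathcomp Require Import boolp freeg.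

Set Implicit Arguments.
Unset Strict Implicit.
Unset Printing Implicit Defensive.

Import GRing.Theory.
Local Open Scope ring_scope.
Local Open Scope quotient_scope.

(* MathComp's [algType R] excludes the zero ring, which is allowed here as an
   R-algebra.  The unital ring structure is put directly on top of [lmodType]
   because HB rejects a join of [pzRingType] and [lmodType] declared after
   [algType]. *)
HB.mixin Record Lmodule_isPzAlgebra (R : pzRingType) A
    of GRing.Lmodule R A := {
  pzalg_one : A;
  pzalg_mul : A -> A -> A;
  pzalg_mulA : associative pzalg_mul;
  pzalg_mul1l : left_id pzalg_one pzalg_mul;
  pzalg_mul1r : right_id pzalg_one pzalg_mul;
  pzalg_mulDl : left_distributive pzalg_mul +%R;
  pzalg_mulDr : right_distributive pzalg_mul +%R;
  pzalg_scaleAl : forall (r : R) (a b : A),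
    r *: pzalg_mul a b = pzalg_mul (r *: a) b;
  pzalg_scaleAr : forall (r : R) (a b : A),
    r *: pzalg_mul a b = pzalg_mul a (r *: b)
}.

#[short(type="pzAlgType")]
HB.structure Definition PzAlgebra (R : pzRingType) :=
  {A of GRing.Lmodule R A & Lmodule_isPzAlgebra R A}.

Definition algebra_hom (R : pzRingType) (A B : pzAlgType R)
    (phi : {linear A -> B}) : Prop :=
  phi pzalg_one = pzalg_one /\
  forall a b, phi (pzalg_mul a b) = pzalg_mul (phi a) (phi b).

(* Every two-sided ideal of a unital R-algebra is an R-submodule, so requiring
   [I] to be a [submodClosed] predicate is no restriction. *)
Definition two_sided_ideal (R : pzRingType) (A : pzAlgType R)
    (I : submodClosed A) : Prop :=
  forall a x : A, x \in I -> pzalg_mul a x \in I /\ pzalg_mul x a \in I.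

Section Submodules.
Variables (R : nzRingType) (V : lmodType R).

Record submod (S : submodClosed V) : Type :=
  Submod { submod_val : V; _ : submod_val \in S }.

Section Instances.
Variable S : submodClosed V.
HB.instance Definition _ := [isSub for @submod_val S].
HB.instance Definition _ := [Choice of submod S by <:].
HB.instance Definition _ := [SubChoice_isSubLmodule of submod S by <:].
End Instances.

Definition submod_incl (S : submodClosed V) : {linear submod S -> V} := \val.

Definition finitely_generated (S : submodClosed V) : Prop :=
  exists (n : nat) (g : 'I_n -> V),
    forall x, x \in S <-> exists c : 'I_n -> R, x = \sum_(i < n) c i *: g i.

(* Repetitions in [s] are harmless for spanning, but not for independence. *)
Definition direct_decomposition (J : eqType) (W : {pred V})
    (F : J -> submodClosed V) : Prop :=
  (forall x, x \in W <->
     exists (s : seq J) (f : J -> V),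
       (forall j, f j \in F j) /\ x = \sum_(j <- s) f j)
  /\
  (forall (s : seq J) (f : J -> V), uniq s -> (forall j, f j \in F j) ->
     \sum_(j <- s) f j = 0 -> forall j, j \in s -> f j = 0).

Definition torsionfree : Prop :=
  forall (r : R) (x : V), r *: x = 0 -> r = 0 \/ x = 0.

End Submodules.

Section Reduction.
Variables (R : comNzRingType) (c : R).

Definition multiples (M : lmodType R) : {pred M} :=
  fun x => `[< exists m : M, x = c *: m >].
Arguments multiples M : clear implicits.

Lemma multiplesP (M : lmodType R) (x : M) :
  reflect (exists m, x = c *: m) (x \in multiples M).
Proof. exact: asboolP. Qed.

Lemma multiples_zmod_closed (M : lmodType R) : zmod_closed (multiples M).
Proof.
split=> [|x y /multiplesP[m ->] /multiplesP[n ->]]; apply/multiplesP.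
  by exists 0; rewrite scaler0.
by exists (m - n); rewrite scalerBr.
Qed.

HB.instance Definition _ (M : lmodType R) :=
  GRing.isZmodClosed.Build M (multiples M) (multiples_zmod_closed M).

Definition reduction (M : lmodType R) : Type := {ideal_quot multiples M}.
HB.instance Definition _ (M : lmodType R) := GRing.Zmodule.on (reduction M).

Definition reduce_mod (M : lmodType R) (m : M) : reduction M :=
  \pi_({ideal_quot multiples M}) m.

Lemma reduce_mod_eq (M : lmodType R) (m n : M) :
  reduce_mod m = reduce_mod n <-> exists p, m - n = c *: p.
Proof.
rewrite /reduce_mod; split=> [/eqP|] h; last apply/eqP; move: h.
  by rewrite -Quotient.idealrBE => /multiplesP.
by rewrite -Quotient.idealrBE => /multiplesP.
Qed.

Variables (M N : lmodType R) (f : {linear M -> N}).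

Definition reduction_map (x : reduction M) : reduction N :=
  reduce_mod (f (repr (x : {ideal_quot multiples M}))).

Lemma reduction_mapE (m : M) : reduction_map (reduce_mod m) = reduce_mod (f m).
Proof.
apply/reduce_mod_eq.
have [|p hp] := (reduce_mod_eq (repr (\pi_({ideal_quot multiples M}) m)) m).1.
  by rewrite /reduce_mod reprK.
by exists (f p); rewrite -linearB hp linearZ.
Qed.

End Reduction.

Section Tensor.
Variable R : comNzRingType.

Section Def.
Variables M N : lmodType R.

Local Notation free := {freeg (M * N)%type / int}.
Local Notation "m *t n" := (<< (m, n) >> : free) (at level 40).

Variant tensor_relator : free -> Prop :=
| Relator_addl m1 m2 n :
    tensor_relator ((m1 + m2) *t n - (m1 *t n + m2 *t n))
| Relator_addr m n1 n2 :
    tensor_relator (m *t (n1 + n2) - (m *t n1 + m *t n2))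
| Relator_scale (r : R) m n :
    tensor_relator ((r *: m) *t n - m *t (r *: n)).

Definition tensor_relations : {pred free} :=
  fun x => `[< forall S : zmodClosed free,
                 (forall g, tensor_relator g -> g \in S) -> x \in S >].

Lemma tensor_relations_zmod_closed : zmod_closed tensor_relations.
Proof.
split=> [|x y /asboolP hx /asboolP hy]; apply/asboolP => S hS.
  exact: rpred0.
by apply: rpredB; [apply: hx | apply: hy].
Qed.

HB.instance Definition _ :=
  GRing.isZmodClosed.Build free tensor_relations tensor_relations_zmod_closed.

Definition tensor : Type := {ideal_quot tensor_relations}.
HB.instance Definition _ := GRing.Zmodule.on tensor.

Definition tens (m : M) (n : N) : tensor :=
  \pi_({ideal_quot tensor_relations}) (m *t n).

Definition balanced (P : zmodType) (b : M -> N -> P) : Prop :=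
  [/\ forall m1 m2 n, b (m1 + m2) n = b m1 n + b m2 n,
      forall m n1 n2, b m (n1 + n2) = b m n1 + b m n2
    & forall r m n, b (r *: m) n = b m (r *: n)].

Definition tensor_lift (P : zmodType) (b : M -> N -> P) (t : tensor) : P :=
  fglift (fun p => b p.1 p.2 : zmodule P)
         (repr (t : {ideal_quot tensor_relations})).

Lemma tens_relator g :
  tensor_relator g -> \pi_({ideal_quot tensor_relations}) g = 0.
Proof.
move=> hg; rewrite -(raddf0 (\pi_({ideal_quot tensor_relations}))).
apply/eqP; rewrite -Quotient.idealrBE subr0; apply/asboolP => S; exact.
Qed.

Lemma tens_balanced : balanced tens.
Proof.
split=> [m1 m2 n|m n1 n2|r m n]; apply/eqP; rewrite -subr_eq0; apply/eqP.
- by have := tens_relator (Relator_addl m1 m2 n); rewrite raddfB raddfD.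
- by have := tens_relator (Relator_addr m n1 n2); rewrite raddfB raddfD.
- by have := tens_relator (Relator_scale r m n); rewrite raddfB.
Qed.

Section Lift.
Variables (P : zmodType) (b : M -> N -> P).
Hypothesis hb : balanced b.

Let L (x : free) : P := fglift (fun p => b p.1 p.2 : zmodule P) x.

Let LB x y : L (x - y) = L x - L y.
Proof. exact: (@lift_is_additive _ _ (zmodule P)). Qed.

Let L0 : L 0 = 0.
Proof. by have := LB 0 0; rewrite !subrr. Qed.

Let LD x y : L (x + y) = L x + L y.
Proof.
have LN : L (- y) = - L y by have := LB 0 y; rewrite L0 !sub0r.
by have := LB x (- y); rewrite LN !opprK.
Qed.

Let LU m n : L (m *t n) = b m n.
Proof. by rewrite /L liftU /= scale1r. Qed.

Let kerL : {pred free} := fun x => L x == 0.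

Let kerL_closed : zmod_closed kerL.
Proof.
split=> [|x y]; rewrite !unfold_in ?L0 // => /eqP hx /eqP hy.
by rewrite LB hx hy subrr.
Qed.

Let L_relations x : x \in tensor_relations -> L x = 0.
Proof.
pose S : zmodClosed free := HB.pack kerL (GRing.isZmodClosed.Build _ kerL kerL_closed).
move=> /asboolP /(_ S) h; apply/eqP; apply: h => g; case: hb => hl hr hs.
rewrite unfold_in /kerL; case=> *;
  by rewrite LB ?LD !LU ?hl ?hr ?hs subrr.
Qed.

Let lift_pi x : tensor_lift b (\pi_({ideal_quot tensor_relations}) x) = L x.
Proof.
rewrite /tensor_lift -/(L _); apply/eqP; rewrite -subr_eq0 -LB; apply/eqP.
by apply: L_relations; rewrite Quotient.idealrBE reprK.
Qed.

Lemma tensor_liftE m n : tensor_lift b (tens m n) = b m n.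
Proof. by rewrite lift_pi LU. Qed.

Lemma tensor_lift_zmod_morphism : zmod_morphism (tensor_lift b).
Proof.
move=> x y; rewrite -[x]reprK -[y]reprK -raddfB !lift_pi; exact: LB.
Qed.

End Lift.

Lemma tensor_sumP (t : tensor) :
  exists s : seq (M * N), t = \sum_(p <- s) tens p.1 p.2.
Proof.
rewrite -[t]reprK; move: (repr _) => x.
pose T (u : tensor) := exists s : seq (M * N), u = \sum_(p <- s) tens p.1 p.2.
have T0 : T 0 by exists [::]; rewrite big_nil.
have TD u v : T u -> T v -> T (u + v).
  by move=> [s ->] [s' ->]; exists (s ++ s'); rewrite big_cat.
have TN u : T u -> T (- u).
  move=> [s ->]; exists [seq (- p.1, p.2) | p <- s].
  rewrite big_map -sumrN; apply: eq_bigr => -[m n] _ /=.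
  apply/eqP; rewrite eq_sym -addr_eq0; have [hl _ _] := tens_balanced.
  rewrite -hl addNr; apply/eqP/(addrI (tens 0 n)).
  by rewrite -hl !addr0.
suff : T (\pi_({ideal_quot tensor_relations}) x) by [].
rewrite -(freeg_sumE x) raddf_sum /=.
elim/big_ind: _ => // -[m n] _.
rewrite -[coeff _ _]intz -freegU_mulz raddfMz /=.
have Tn k : T (tens m n *+ k).
  by elim: k => // k ih; rewrite mulrS; apply: TD => //;
     exists [:: (m, n)]; rewrite big_seq1.
by case: (coeff _ _) => k; [|rewrite NegzE -nmulrn; apply: (TN)]; apply: Tn.
Qed.

End Def.

Definition tensor_map (M M' N N' : lmodType R)
    (f : {linear M -> M'}) (g : {linear N -> N'}) :
    tensor M N -> tensor M' N' :=
  tensor_lift (fun m n => tens (f m) (g n)).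

Lemma tensor_map_balanced (M M' N N' : lmodType R)
    (f : {linear M -> M'}) (g : {linear N -> N'}) :
  balanced (fun m n => tens (f m) (g n)).
Proof.
have [hl hr hs] := tens_balanced M' N'.
by split=> *; rewrite ?linearD ?linearZ ?hl ?hr ?hs.
Qed.

Lemma tensor_mapE (M M' N N' : lmodType R)
    (f : {linear M -> M'}) (g : {linear N -> N'}) m n :
  tensor_map f g (tens m n) = tens (f m) (g n).
Proof. exact/tensor_liftE/tensor_map_balanced. Qed.

Lemma tensor_map_zmod_morphism (M M' N N' : lmodType R)
    (f : {linear M -> M'}) (g : {linear N -> N'}) :
  zmod_morphism (tensor_map f g).
Proof. exact/tensor_lift_zmod_morphism/tensor_map_balanced. Qed.

End Tensor.

Section Laurent.
Variables (k0 k : fieldType) (iota : {rmorphism k0 -> k}) (q : k).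

Definition laurent : {pred k} :=
  fun x => `[< exists (p : {poly k0}) (n : nat),
                 x = (map_poly iota p).[q] / q ^+ n >].

Lemma laurentP x :
  reflect (exists (p : {poly k0}) (n : nat), x = (map_poly iota p).[q] / q ^+ n)
          (x \in laurent).
Proof. exact: asboolP. Qed.

Lemma laurent_q : q \in laurent.
Proof.
by apply/laurentP; exists 'X, 0; rewrite map_polyX hornerX expr0 divr1.
Qed.

Lemma laurent_subring_closed : subring_closed laurent.
Proof.
split.
- apply/laurentP; exists 1, 0; by rewrite rmorph1 hornerC expr0 divr1.
- move=> x y /laurentP[p [n ->]] /laurentP[r [m ->]]; apply/laurentP.
  have [q0|q0] := eqVneq q 0.
    have E0 (u : {poly k0}) (l : nat) : (map_poly iota u).[q] / q ^+ l =
        iota (if l == 0%N then u`_0 else 0).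
      rewrite q0 horner_coef0 coef_map; case: l => [|l].
        by rewrite expr0 divr1.
      by rewrite expr0n /= invr0 mulr0 rmorph0.
    exists ((if n == 0%N then p`_0 else 0) - (if m == 0%N then r`_0 else 0))%:P, 0%N.
    by rewrite !E0 coefC /= rmorphB.
  exists (p * 'X^m - r * 'X^n), (n + m)%N.
  rewrite rmorphB !rmorphM /= !map_polyXn hornerD hornerN !hornerM !hornerXn.
  rewrite mulrBl exprD !invfM; congr (_ - _).
    by rewrite mulrACA divff ?expf_neq0 // mulr1.
  by rewrite [q ^- n * _]mulrC mulrACA divff ?expf_neq0 // mulr1.
- move=> x y /laurentP[p [n ->]] /laurentP[r [m ->]]; apply/laurentP.
  exists (p * r), (n + m)%N.
  by rewrite rmorphM hornerM exprD invfM mulrACA.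
Qed.

HB.instance Definition _ :=
  GRing.isSubringClosed.Build k laurent laurent_subring_closed.

Record laurent_ring : Type :=
  LaurentRing { laurent_val : k; _ : laurent_val \in laurent }.

HB.instance Definition _ := [isSub for laurent_val].
HB.instance Definition _ := [Choice of laurent_ring by <:].
HB.instance Definition _ := [SubChoice_isSubComNzRing of laurent_ring by <:].

Definition laurent_gen : laurent_ring := LaurentRing laurent_q.

End Laurent.

(* k as a module over its subring k0[q, 1/q]; [iota] and [q] are parameters so
   that the scalars can be recovered from the type. *)
Definition laurent_ext (k0 k : fieldType) (iota : {rmorphism k0 -> k})
  (q : k) : Type := k.

Section LaurentExt.
Variables (k0 k : fieldType) (iota : {rmorphism k0 -> k}) (q : k).
Local Notation laurent_ring := (laurent_ring iota q).
Local Notation laurent_ext := (laurent_ext iota q).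

HB.instance Definition _ := GRing.Field.on laurent_ext.

Definition laurent_scale (r : laurent_ring) (x : laurent_ext) : laurent_ext :=
  (laurent_val r : laurent_ext) * x.

Fact laurent_scaleA r s x :
  laurent_scale r (laurent_scale s x) = laurent_scale (r * s) x.
Proof. exact: mulrA. Qed.
Fact laurent_scale1 : left_id 1 laurent_scale.
Proof. exact: mul1r. Qed.
Fact laurent_scaleDr : right_distributive laurent_scale +%R.
Proof. by move=> r x y; exact: mulrDr. Qed.
Fact laurent_scaleDl x : {morph laurent_scale^~ x : r s / r + s}.
Proof. by move=> r s; exact: mulrDl. Qed.

HB.instance Definition _ :=
  GRing.Zmodule_isLmodule.Build laurent_ring laurent_ext
    laurent_scaleA laurent_scale1 laurent_scaleDr laurent_scaleDl.

End LaurentExt.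

(* Main.v *)
(* Write K for the kernel of phi and F for the fraction field of R.  Torsion-freeness
   of B turns the hypothesis on the reductions into K_j = I_j + (q - 1) K_j, hence
   K_j = I_j + (q - 1)^m K_j for all m.  If x in K_j were nontorsion modulo I, an
   R-linear mu : A -> F would exist with mu I = 0 and mu x = 1 (Zorn); since A_j is
   finitely generated, mu has a common denominator d on A_j, and then d is divisible
   by every power of q - 1, which is absurd.  So K / I is torsion, and the images of
   k (x) K and k (x) I in k (x) A agree because R - {0} is invertible in k.

   That the kernel of id (x) phi is the image of k (x) K is shown by induction on the
   length of t = sum c_i (x) a_i.  If phi a_1 <> 0, a functional mu : B -> F with
   mu (phi a_1) = 1 applied to sum c_i (x) phi a_i = 0 gives
   c_1 = - sum_(i > 1) c_i mu (phi a_i), so t is a sum of fewer tensors. *)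

From HB Require Import structures.
Require Import Defs.
From mathcomp Require Import all_boot all_algebra.
From mathcomp Require Import generic_quotient ring_quotient boolp classical_sets.
Set Implicit Arguments.
Unset Strict Implicit.
Unset Printing Implicit Defensive.

Import GRing.Theory.
Local Open Scope ring_scope.

(** * Saturated submodules, those with torsionfree quotient, and functionals with fractional
    values *)

Definition saturated_submodule {R : pzRingType} {M : lmodType R}
    (W : set M) : Prop :=
  [/\ W 0, forall (a : R) x y, W x -> W y -> W (a *: x + y)
    & forall (a : R) x, a != 0 -> W (a *: x) -> W x].

Section FractionFunctional.
Context (R : comNzRingType) (k : fieldType) (v : {rmorphism R -> k}).
Hypothesis v_inj : injective v.
Context (M : lmodType R).
Implicit Types (U W : set M) (a r s : R) (x y : M).

Lemma inj_rmorph_neq0 r : (v r != 0) = (r != 0).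
Proof. by rewrite -[0 in LHS](rmorph0 v) (inj_eq v_inj). Qed.

Lemma inj_rmorph_mulf_neq0 r s : r != 0 -> s != 0 -> r * s != 0.
Proof. by rewrite -!inj_rmorph_neq0 rmorphM => *; rewrite mulf_neq0. Qed.

Lemma saturatedZ W a x : saturated_submodule W -> W x -> W (a *: x).
Proof. by case=> W0 WD _ Wx; rewrite -[_ *: _]addr0; apply: WD. Qed.

Lemma saturatedD W x y : saturated_submodule W -> W x -> W y -> W (x + y).
Proof. by case=> _ WD _ Wx Wy; rewrite -[x]scale1r; apply: WD. Qed.

Lemma saturatedB W x y : saturated_submodule W -> W x -> W y -> W (x - y).
Proof. by case=> _ WD _ Wx Wy; rewrite addrC -scaleN1r; apply: WD. Qed.

(** Given [r x = s z] and [r' y = s' z] modulo a submodule, cross-multiplying by the denominators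
    yields such a congruence for [a x + y]. *)
Lemma scaled_difference_lincomb a r s r' s' x y z :
  (r * r') *: (a *: x + y) - (r' * a * s + r * s') *: z =
  (r' * a) *: (r *: x - s *: z) + r *: (r' *: y - s' *: z).
Proof.
rewrite !scalerBr scalerDr scalerDl !scalerA opprD addrACA.
by rewrite -[r * r' * a]mulrA [r * (r' * a)]mulrC.
Qed.

Lemma maximal_saturated_avoiding U x0 :
  saturated_submodule U -> ~ U x0 ->
  exists W, [/\ saturated_submodule W, (U `<=` W)%classic, ~ W x0
    & forall W', saturated_submodule W' -> (W `<=` W')%classic -> ~ W' x0 ->
        (W' `<=` W)%classic].
Proof.
move=> satU Ux0.
(* Zorn's lemma also tests the empty chain, whose union is empty; joining [U] to every set makes
   that case harmless. *)
pose P (X : set M) :=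
  saturated_submodule (X `|` U)%classic /\ ~ (X `|` U)%classic x0.
have [F FP Ftot|X [[satX Xx0] maxX]] := @Zorn_bigcup M P; last first.
  exists (X `|` U)%classic; split=> // W' satW' sub W'x0 x W'x.
  apply: contrapT => nXx.
  have W'U : (W' `|` U)%classic = W'.
    by apply/seteqP; split=> [y [//|Uy]|y W'y]; [apply: sub; right | left].
  apply: (maxX W'); last by rewrite /P W'U.
  split=> [y Xy|/(_ x W'x) Xx]; last by apply: nXx; left.
  by apply: sub; left.
(* Totality of the chain puts two elements of the union in one member joined with [U]; the
   alternative with both in [U] covers the empty chain. *)
have common x y : (\bigcup_(X in F) X `|` U)%classic x ->
    (\bigcup_(X in F) X `|` U)%classic y ->
    (U x /\ U y) \/ exists2 X, F X & (X `|` U)%classic x /\ (X `|` U)%classic y.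
  move=> [[X FX Xx]|Ux] [[Y FY Yy]|Uy]; last by left.
  - have [XY|YX] := Ftot X Y FX FY; right.
      by exists Y => //; split; left=> //; apply: XY.
    by exists X => //; split; left=> //; apply: YX.
  - by right; exists X => //; split; [left|right].
  - by right; exists Y => //; split; [right|left].
have widen X x : F X -> (X `|` U)%classic x -> (\bigcup_(X in F) X `|` U)%classic x.
  by move=> FX [Xx|Ux]; [left; exists X | right].
split; last first.
  by move=> /[dup] h /(common _ _ h)[[]//|[X /FP[_ nXx0] []]].
split=> [|a x y hx hy|a x a0 hx]; first by right; case: satU.
  have [[Ux Uy]|[X FX [Xx Xy]]] := common _ _ hx hy.
    by right; case: satU => _ UD _; apply: UD.
  by apply: (widen X) => //; case: (FP _ FX) => -[_ XD _] _; apply: XD.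
have [[Ux _]|[X FX [Xx _]]] := common _ _ hx hx.
  by right; case: satU => _ _ US; apply: US Ux.
by apply: (widen X) => //; case: (FP _ FX) => -[_ _ XS] _; apply: XS Xx.
Qed.

(** By maximality, every saturated submodule strictly larger than [W] contains [x0], so the quotient
    by [W] has rank one. *)
Lemma maximal_saturated_rank1 U x0 :
  saturated_submodule U -> ~ U x0 ->
  exists W, [/\ saturated_submodule W, (U `<=` W)%classic, ~ W x0
    & forall x, exists r s, r != 0 /\ W (r *: x - s *: x0)].
Proof.
move=> satU /(maximal_saturated_avoiding satU)[W [satW UW Wx0 maxW]].
exists W; split=> // x; have [W0 WD WS] := satW.
pose W' : set M := fun z => exists r s, r != 0 /\ W (r *: z - s *: x).
have satW' : saturated_submodule W'.
  split=> [|a y z [r [s [r0 Wy]]] [r' [s' [r'0 Wz]]]|a y a0 [r [s [r0 Wy]]]].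
  - by exists 1, 0; rewrite oner_neq0 scaler0 scale0r subrr.
  - exists (r * r'), (r' * a * s + r * s'); rewrite inj_rmorph_mulf_neq0 //.
    split=> //.
    by rewrite scaled_difference_lincomb; apply: WD => //; apply: saturatedZ.
  - by exists (r * a), s; rewrite inj_rmorph_mulf_neq0 // -scalerA.
have WW' : (W `<=` W')%classic.
  by move=> z Wz; exists 1, 0; rewrite oner_neq0 scale1r scale0r subr0.
have W'x : W' x by exists 1, 1; rewrite oner_neq0 subrr.
(* [W'] is the saturation of [W + R x]: if [x] is not in [W], it contains [x0]. *)
have [[r [s [r0 Wrs]]]|W'x0] := pselect (W' x0); last first.
  by exists 1, 0; rewrite oner_neq0 scale1r scale0r subr0; split=> //; apply: (maxW W').
(* The relation found for [x0] is read backwards; [s = 0] would force [x0] into [W] by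
   saturation. *)
exists s, r; split; last by rewrite -opprB -scaleN1r; apply: saturatedZ.
apply/eqP => s0; apply: Wx0; apply: (WS r) => //.
by rewrite s0 scale0r subr0 in Wrs.
Qed.

(** Modulo a maximal [W], each [x] is a fraction [s / r] times [x0]; [mu x] is this fraction,
    computed in [k]. *)
Lemma fraction_functional U x0 :
  saturated_submodule U -> ~ U x0 ->
  exists mu : {additive M -> k},
    [/\ forall r x, mu (r *: x) = v r * mu x,
        mu x0 = 1, forall x, U x -> mu x = 0
      & forall x, exists r s, r != 0 /\ v r * mu x = v s].
Proof.
move=> satU /(maximal_saturated_rank1 satU)[W [satW UW Wx0 rank1]].
have [W0 WD WS] := satW.
(* [G] is the graph of [mu]. It is single-valued: two different fractions for one [x] would put a
   nonzero multiple of [x0], hence [x0], in [W]. *)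
pose G x c := exists r s, [/\ r != 0, W (r *: x - s *: x0) & v r * c = v s].
have Gfun x c d : G x c -> G x d -> c = d.
  move=> [r [s [r0 Wrs ec]]] [r' [s' [r'0 Wrs' ed]]].
  have h : W ((r * s' - r' * s) *: x0).
    have := saturatedB satW (saturatedZ r' satW Wrs) (saturatedZ r satW Wrs').
    rewrite !scalerBr !scalerA [r' * r]mulrC opprB addrC addrA subrK.
    by rewrite -scalerBl.
  have e : r * s' - r' * s = 0.
    by apply/eqP; apply: contrapT => /negP n0; apply: Wx0; apply: WS n0 h.
  apply: (@mulfI _ (v r * v r')); first by rewrite mulf_neq0 ?inj_rmorph_neq0.
  rewrite -mulrA mulrCA ec -mulrA ed -!rmorphM.
  by move/eqP: e; rewrite subr_eq0 => /eqP ->.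
have Gtot x : exists c, G x c.
  have [r [s [r0 Wrs]]] := rank1 x; exists (v s / v r), r, s; split=> //.
  by rewrite mulrC divfK // inj_rmorph_neq0.
have [mu Gmu] := choice Gtot.
have Glin a x y c d : G x c -> G y d -> G (a *: x + y) (v a * c + d).
  move=> [r [s [r0 Wrs ec]]] [r' [s' [r'0 Wrs' ed]]].
  exists (r * r'), (r' * a * s + r * s'); split.
  - by rewrite inj_rmorph_mulf_neq0.
  - by rewrite scaled_difference_lincomb; apply: WD => //; apply: saturatedZ.
  - rewrite rmorphD !rmorphM -ec -ed mulrDr; congr (_ + _); last by rewrite mulrA.
    by rewrite -!mulrA mulrCA [v r * (v a * c)]mulrCA.
have muP a x y : mu (a *: x + y) = v a * mu x + mu y.
  by apply: (Gfun (a *: x + y)) => //; apply: Glin.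
have muB : zmod_morphism mu.
  by move=> x y; rewrite addrC -scaleN1r muP rmorphN1 mulN1r addrC.
pose m : {additive M -> k} := HB.pack mu (GRing.isZmodMorphism.Build _ _ mu muB).
have mE x : m x = mu x by [].
exists m; split.
- by move=> r x; have := muP r x 0; rewrite -!mE addr0 raddf0 addr0.
- apply: (Gfun x0) => //; exists 1, 1.
  by rewrite oner_neq0 subrr rmorph1 mulr1.
- move=> x /UW Wx; apply: (Gfun x) => //; exists 1, 0.
  by rewrite oner_neq0 scale1r scale0r subr0 rmorph1 rmorph0 mulr0.
- by move=> x; have [r [s [r0 _ e]]] := Gmu x; exists r, s.
Qed.

End FractionFunctional.

(** * Divisibility by powers of [q - 1] in [R] *)

Section LaurentDivisibility.
Context (k0 k : fieldType) (iota : {rmorphism k0 -> k}) (q : k).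
Local Notation R := (laurent_ring iota q).

Definition laurent_inj : {rmorphism R -> k} := \val.

Lemma laurent_inj_inj : injective laurent_inj.
Proof. exact: val_inj. Qed.

Lemma laurent_injE (r : R) : laurent_inj r = laurent_val r.
Proof. by []. Qed.

Hypothesis q_transcendental : ~ algebraicOver iota q.

Lemma transcendental_horner_inj (p r : {poly k0}) :
  (map_poly iota p).[q] = (map_poly iota r).[q] -> p = r.
Proof.
move=> e; apply/eqP; rewrite -subr_eq0; apply: contrapT => /negP n0.
apply: q_transcendental; exists (p - r) => //.
by rewrite rmorphB rootE hornerD hornerN e subrr.
Qed.

Lemma transcendental_neq0 : q != 0.
Proof.
apply/eqP => q0; apply: q_transcendental; exists 'X; first by rewrite polyX_eq0.
by rewrite map_polyX rootE hornerX q0.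
Qed.

Lemma laurent_gen_sub1_neq0 : laurent_gen iota q - 1 != 0.
Proof.
rewrite -(inj_rmorph_neq0 laurent_inj_inj) rmorphB rmorph1 laurent_injE /= subr_eq0.
apply/eqP => q1; have := @transcendental_horner_inj 'X 1.
rewrite map_polyX hornerX rmorph1 hornerC => /(_ q1) /eqP.
by rewrite -subr_eq0 polyXsubC_eq0.
Qed.

(** By transcendence, clearing powers of [q] gives an identity of polynomials. As [X - 1] is coprime
    to [X], its powers must divide the numerator [p] of [d], which bounds the exponent unless
    [p = 0]. *)
Lemma laurent_gen_sub1_separated (d : R) :
  (forall m, exists r, d = (laurent_gen iota q - 1) ^+ m * r) -> d = 0.
Proof.
move=> dvd_d; have qn0 n : q ^+ n != 0 by rewrite expf_neq0 ?transcendental_neq0.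
have [p [n dE]] := laurentP _ _ _ (valP d).
suff p0 : p = 0 by apply: val_inj; rewrite [LHS]dE p0 rmorph0 horner0 mul0r.
apply: contrapT => /eqP p0.
(* The exponent [size p] is one more than the degree of [p]. *)
have [r dr] := dvd_d (size p).
have [u [l rE]] := laurentP _ _ _ (valP r).
have e : p * 'X^l = ('X - 1) ^+ size p * u * 'X^n.
  apply: transcendental_horner_inj.
  rewrite !rmorphM !rmorphXn /= rmorphB /= map_polyX rmorph1 !hornerM !horner_exp.
  rewrite hornerD hornerN hornerX hornerC.
  have := congr1 laurent_inj dr; rewrite rmorphM rmorphXn rmorphB rmorph1 !laurent_injE /=.
  have -> : laurent_val d = val d by [].
  have -> : laurent_val r = val r by [].
  rewrite dE rE => /(canRL (divfK (qn0 n))) ->.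
  by rewrite !mulrA mulrAC divfK.
have : (('X - 1) ^+ size p %| p * 'X^l) by rewrite e -mulrA dvdp_mulr.
rewrite Gauss_dvdpl; last first.
  rewrite coprimep_expl // coprimep_expr // coprimep_sym.
  by rewrite -['X - 1]/('X - 1%:P) coprimep_XsubC rootE hornerX oner_neq0.
move=> /(dvdp_leq p0); rewrite -['X - 1]/('X - 1%:P) size_exp_XsubC.
by rewrite ltnn.
Qed.

End LaurentDivisibility.

(** The product of denominators of [mu] on the generators serves; it is nonzero because [R] embeds
    in a field. *)
Lemma fraction_functional_denominator (R : comNzRingType) (k : fieldType)
    (v : {rmorphism R -> k}) (v_inj : injective v) (M : lmodType R)
    (mu : {additive M -> k}) (S : submodClosed M) :
  (forall r x, mu (r *: x) = v r * mu x) ->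
  (forall x, exists r s, r != 0 /\ v r * mu x = v s) ->
  finitely_generated S ->
  exists2 d, d != 0 & forall x, x \in S -> exists r, v d * mu x = v r.
Proof.
move=> muZ mu_frac [n [g Sg]].
have [d dP] := choice (fun i => mu_frac (g i)).
exists (\prod_i d i).
  rewrite -(inj_rmorph_neq0 v_inj) rmorph_prod prodf_seq_neq0.
  by apply/allP => i _; rewrite (inj_rmorph_neq0 v_inj); have [? []] := dP i.
move=> x /Sg[c ->]; have [e eP] := choice (fun i => dP i).
(* In each term the denominator [d i] turns [mu (g i)] into [e i], and the other denominators remain
   as a factor. *)
exists (\sum_i c i * (\prod_(j | j != i) d j) * e i).
rewrite raddf_sum mulr_sumr rmorph_sum; apply: eq_bigr => i _.
have [_ ei] := eP i.
rewrite muZ (bigD1 i) //= [d i * _]mulrC !rmorphM -ei.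
by rewrite mulrCA -!mulrA.
Qed.

(** * Expansions with finite support in direct decompositions *)

Section Decompositions.
Context (R : nzRingType) (V : lmodType R) (J : eqType).

Lemma big_uniq_support (s t : seq J) (f : J -> V) :
  uniq s -> uniq t -> {subset s <= t} -> (forall j, j \notin s -> f j = 0) ->
  \sum_(j <- s) f j = \sum_(j <- t) f j.
Proof.
move=> us ut st f0.
rewrite [RHS](bigID (mem s)) /= [X in _ = _ + X]big1 // addr0 -[RHS]big_filter.
apply: perm_big; apply: uniq_perm => // [|j]; first exact: filter_uniq.
by rewrite mem_filter; case: (boolP (j \in s)) => // /st ->.
Qed.

(** Indices may repeat in a given expansion, so multiplicities are absorbed into the components.
    Vanishing outside [s] later allows [s] to be enlarged. *)
Lemma direct_decomposition_support (W : {pred V}) (F : J -> submodClosed V) x :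
  direct_decomposition W F -> x \in W ->
  exists s f, [/\ uniq s, forall j, f j \in F j,
    forall j, j \notin s -> f j = 0 & x = \sum_(j <- s) f j].
Proof.
move=> [Wsum _] /Wsum[s [f [fF ->]]].
exists (undup s), (fun j => f j *+ count_mem j s); split.
- exact: undup_uniq.
- by move=> j; apply: rpredMn.
- by move=> j; rewrite mem_undup => /count_memPn ->.
- rewrite -big_undup_iterop_count; apply: eq_bigr => j _.
  by elim: (count_mem j s) => // -[|n] // IH; rewrite mulrS -IH.
Qed.

Lemma direct_decomposition_component_eq0 (W : {pred V})
    (F : J -> submodClosed V) (s : seq J) (f : J -> V) :
  direct_decomposition W F -> uniq s -> (forall j, f j \in F j) ->
  (forall j, j \notin s -> f j = 0) ->
  \sum_(j <- s) f j = 0 -> forall j, f j = 0.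
Proof.
move=> [_ Fdirect] us fF f0 sum0 j.
by have [/(Fdirect s f us fF sum0)//|/f0] := boolP (j \in s).
Qed.

End Decompositions.

(** * The kernel of [phi] modulo [I] and powers of a scalar [c], later [q - 1] *)

Lemma reduction_kernel_lift (R : comNzRingType) (c : R) (A B : lmodType R)
    (phi : {linear A -> B}) (I : submodClosed A) :
  (forall x : reduction c A, reduction_map phi x = 0 ->
     exists y : reduction c (submod I), x = reduction_map (submod_incl I) y) ->
  forall x, phi x = 0 -> exists2 a, a \in I & exists p, x - a = c *: p.
Proof.
move=> ker x phix0; have [|y] := ker (reduce_mod c x).
  rewrite reduction_mapE phix0.
  exact: (raddf0 (\pi_({ideal_quot @multiples R c B})%qT)).
have [z <-] : exists z, reduce_mod c z = y by exists (repr y); rewrite /reduce_mod reprK.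
rewrite reduction_mapE => /reduce_mod_eq h.
by exists (submod_incl I z) => //; apply: valP.
Qed.

Lemma submodClosedB (R : nzRingType) (V : lmodType R) (S : submodClosed V) x y :
  x \in S -> y \in S -> x - y \in S.
Proof. by move=> xS yS; rewrite rpredD // -scaleN1r rpredZ. Qed.

Section GradedKernel.
Context (R : comNzRingType) (c : R) (A B : lmodType R) (phi : {linear A -> B}).
Context (I : submodClosed A).
Hypothesis I_ker : forall x, x \in I -> phi x = 0.
Hypothesis B_torsionfree : torsionfree B.
Hypothesis c_neq0 : c != 0.
Context (J : eqType) (Ij Aj : J -> submodClosed A) (Bj : J -> submodClosed B).
Hypothesis I_decomposition : direct_decomposition I Ij.
Hypothesis A_decomposition : direct_decomposition predT Aj.
Hypothesis B_decomposition : direct_decomposition predT Bj.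
Hypothesis Ij_sub_Aj : forall j, {subset Ij j <= Aj j}.
Hypothesis phi_Aj_Bj : forall j x, x \in Aj j -> phi x \in Bj j.
Hypothesis kernel_lift :
  forall x, phi x = 0 -> exists2 a, a \in I & exists p, x - a = c *: p.

(** Since [phi] respects the decompositions, it sends the components of [x] to those of [phi x = 0],
    which vanish by independence in [B]. *)
Lemma kernel_component (x : A) : phi x = 0 ->
  exists s f, [/\ uniq s, forall j, f j \in Aj j, forall j, phi (f j) = 0,
    forall j, j \notin s -> f j = 0 & x = \sum_(j <- s) f j].
Proof.
move=> phix0.
have [|s [f [us fA f0 xE]]] := direct_decomposition_support (x := x) A_decomposition.
  by [].
exists s, f; split=> //.
apply: (direct_decomposition_component_eq0 B_decomposition us).
- by move=> j; apply: phi_Aj_Bj.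
- by move=> j /f0 ->; rewrite linear0.
- by rewrite -linear_sum -xE.
Qed.

(** Write [x = a + c p] with [a] in [I]. Then [c *: phi p = 0], so [phi p = 0] by torsion-freeness,
    and comparing components at [j] gives [x - c p_j = a_j]. *)
Lemma graded_kernel_step j (x : A) : x \in Aj j -> phi x = 0 ->
  exists x', [/\ x' \in Aj j, phi x' = 0 & x - c *: x' \in I].
Proof.
move=> xA phix0; have [a aI [p xap]] := kernel_lift phix0.
have phip0 : phi p = 0.
  have [|/eqP|//] := B_torsionfree (r := c) (x := phi p).
    by rewrite -linearZ -xap linearB phix0 I_ker // subrr.
  by rewrite (negPf c_neq0).
have [sa [fa [usa faI fa0 aE]]] := direct_decomposition_support I_decomposition aI.
have [sp [fp [usp fpA phifp fp0 pE]]] := kernel_component phip0.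
exists (fp j); split=> //.
pose fx i := if i == j then x else 0.
(* A common index list on which the expansions of [x], [a] and [p] can be subtracted termwise. *)
pose t := undup (j :: sa ++ sp).
have ut : uniq t := undup_uniq _.
have subt u : {subset u <= j :: sa ++ sp} -> {subset u <= t}.
  by move=> sub i /sub; rewrite mem_undup.
have xE : x = \sum_(i <- t) fx i.
  rewrite -(@big_uniq_support _ _ _ [:: j]) // ?big_seq1 /fx ?eqxx //.
    by apply: subt => i; rewrite !inE => ->.
  by move=> i; rewrite inE => /negPf ->.
rewrite (big_uniq_support (t := t)) // in aE; last first.
  by apply: subt => i; rewrite inE mem_cat => ->; rewrite orbT.
rewrite (big_uniq_support (t := t)) // in pE; last first.
  by apply: subt => i; rewrite inE mem_cat => ->; rewrite !orbT.
have : fx j - fa j - c *: fp j = 0.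
  apply: (direct_decomposition_component_eq0 (s := t)
            (f := fun i => fx i - fa i - c *: fp i) A_decomposition ut).
  - move=> i /=; apply: submodClosedB; last exact: rpredZ.
    apply: submodClosedB; last exact: Ij_sub_Aj.
    by rewrite /fx; case: eqP => [->|_] //; apply: rpred0.
  - move=> i; rewrite mem_undup inE mem_cat !negb_or => /and3P[ij isa isp].
    by rewrite /fx (negPf ij) fa0 // fp0 // scaler0 !subr0.
  - by rewrite !sumrB -xE -aE -scaler_sumr -pE xap subrr.
rewrite /fx eqxx addrAC => /eqP; rewrite subr_eq0 => /eqP ->.
apply/(I_decomposition.1 _).2; exists [:: j], (fun i => if i == j then fa j else 0).
split; last by rewrite big_seq1 eqxx.
by move=> i; case: eqP => [->|_] //; apply: rpred0.
Qed.

Lemma graded_kernel_iterate j (x : A) m : x \in Aj j -> phi x = 0 ->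
  exists x', [/\ x' \in Aj j, phi x' = 0 & x - c ^+ m *: x' \in I].
Proof.
move=> xA phix0; elim: m => [|m [y [yA phiy0 xy]]].
  by exists x; rewrite scale1r subrr rpred0.
have [z [zA phiz0 yz]] := graded_kernel_step yA phiy0.
exists z; split=> //; rewrite -(subrK (c ^+ m *: y) x) -addrA exprSr -scalerA.
by rewrite -scalerBr rpredD // rpredZ.
Qed.

End GradedKernel.

(** [I] need not be saturated itself; its saturation is what a functional killing [I] is built
    from. *)
Lemma saturation_saturated (R : comNzRingType) (k : fieldType)
    (v : {rmorphism R -> k}) (v_inj : injective v) (M : lmodType R)
    (I : submodClosed M) :
  saturated_submodule
    ((fun x => exists2 s : R, s != 0 & s *: x \in I) : set M).
Proof.
split=> [|a x y [s s0 sx] [r r0 ry]|a x a0 [s s0 sax]].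
- by exists 1; rewrite ?oner_neq0 // scaler0 rpred0.
- exists (s * r); first exact: (inj_rmorph_mulf_neq0 v_inj).
  rewrite scalerDr scalerA rpredD //; last by rewrite -scalerA rpredZ.
  by rewrite -mulrA mulrC -scalerA rpredZ.
- by exists (s * a); rewrite -?scalerA //; apply: (inj_rmorph_mulf_neq0 v_inj).
Qed.

(** * The kernel of [id (x) phi] on [k (x) A] *)

Section TensorKernel.
Context (k0 k : fieldType) (iota : {rmorphism k0 -> k}) (q : k).
Local Notation R := (laurent_ring iota q).
Local Notation K := (laurent_ext iota q).
Local Notation v := (laurent_inj iota q).
Let v_inj : injective v := @laurent_inj_inj k0 k iota q.

Lemma laurent_ext_scaleE (r : R) (x : K) : r *: x = v r * x.
Proof. by []. Qed.

Section Additivity.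
Context (M N P Q : lmodType R) (f : {linear M -> N}) (g : {linear P -> Q}).
HB.instance Definition _ :=
  GRing.isZmodMorphism.Build _ _ (tensor_map f g) (tensor_map_zmod_morphism f g).
End Additivity.

Lemma tens_sum_left (M : lmodType R) (T : Type) (s : seq T) (F : T -> K) (x : M) :
  tens (\sum_(i <- s) F i) x = \sum_(i <- s) tens (F i) x.
Proof.
have [hl _ _] := tens_balanced K M.
elim: s => [|i s IH]; last by rewrite !big_cons hl IH.
by rewrite !big_nil; apply: (addrI (tens 0 x)); rewrite -hl !addr0.
Qed.

Lemma tens0 (M : lmodType R) (a : K) : tens a (0 : M) = 0.
Proof.
have [_ hr _] := tens_balanced K M.
by apply: (addrI (tens a 0)); rewrite -hr !addr0.
Qed.

(** Nonzero scalars of [R] are invertible in [k], so a vector may be replaced by any nonzero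
    multiple. *)
Lemma tens_clear_denominator (M : lmodType R) (a : K) (r : R) (x : M) :
  r != 0 -> tens (a / v r : K) (r *: x) = tens a x.
Proof.
move=> r0; have [_ _ hs] := tens_balanced K M.
by rewrite -hs laurent_ext_scaleE mulrC divfK // (inj_rmorph_neq0 v_inj).
Qed.

Context (A B : lmodType R) (phi : {linear A -> B}) (I : submodClosed A).
Hypothesis B_torsionfree : torsionfree B.
Hypothesis kernel_torsion :
  forall x, phi x = 0 -> exists2 s : R, s != 0 & s *: x \in I.

Lemma tensor_kernel_sub_image (t : tensor K A) :
  tensor_map idfun phi t = 0 ->
  exists u : tensor K (submod I), t = tensor_map idfun (submod_incl I) u.
Proof.
have [s ->] := tensor_sumP t.
(* The list [s'] used below is not a tail of the given one, so the induction is on a bound for the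
   length. *)
have [n sn] := ubnP (size s); elim: n => // n IH in s sn *.
case: s sn => [|[a x] s] /= sn; first by move=> _; exists 0; rewrite raddf0 big_nil.
rewrite big_cons /=; have [phix0|/eqP phix0] := eqVneq (phi x) 0.
  rewrite raddfD /= tensor_mapE phix0 tens0 add0r => /(IH s sn)[u ->].
  (* [a (x) x] equals [(a / r) (x) (r x)], which comes from [k (x) I]. *)
  have [r r0 rx] := kernel_torsion phix0.
  exists (tens (a / v r : K) (Submod rx) + u).
  by rewrite raddfD /= tensor_mapE /= tens_clear_denominator.
have sat0 : saturated_submodule ((fun y => y = 0) : set B).
  split=> // [r y z -> ->|r y r0]; first by rewrite scaler0 addr0.
  by case/B_torsionfree => // /eqP; rewrite (negPf r0).
have [mu [muZ mux _ mu_frac]] := fraction_functional v_inj sat0 phix0.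
have [hl hr hs] := tens_balanced K A.
(* This pairing extends [mu] to an additive map [k (x) B -> k]. *)
pose b (c : K) (y : B) : k := c * mu y.
have bal_b : balanced b.
  split=> [c d y|c y z|r c y]; rewrite /b ?raddfD ?mulrDl ?mulrDr ?muZ //.
  by rewrite laurent_ext_scaleE mulrA [v r * _]mulrC.
have [L LE] : exists L : {additive tensor K B -> k},
    forall c y, L (tens c y) = c * mu y.
  pose L : {additive tensor K B -> k} := HB.pack (tensor_lift b)
    (GRing.isZmodMorphism.Build _ _ (tensor_lift b)
      (tensor_lift_zmod_morphism bal_b)).
  by exists L; exact: tensor_liftE.
move=> tker.
have aE : a = \sum_(p <- s) - (p.1 * mu (phi p.2)) :> k.
  have := congr1 L tker; rewrite raddf0 !raddfD /= tensor_mapE LE mux mulr1 /=.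
  rewrite !raddf_sum sumrN => /eqP; rewrite addr_eq0 => /eqP ->; congr (- _).
  by apply: eq_bigr => p _; rewrite /= tensor_mapE LE.
have [r rP] := choice (fun y => mu_frac y).
have [r' r'P] := choice rP.
(* Substituting for [a] turns each [c (x) y] into [c (x) y - c mu(phi y) (x) x]. With
   [mu(phi y) = r' / r] this is the single tensor [(c / r) (x) (r y - r' x)]. *)
pose s' := [seq ((p.1 / v (r (phi p.2)) : K),
                 r (phi p.2) *: p.2 - r' (phi p.2) *: x) | p <- s].
suff sE : tens a x + \sum_(p <- s) tens p.1 p.2 = \sum_(p <- s') tens p.1 p.2.
  by rewrite sE in tker *; apply: IH tker; rewrite size_map.
rewrite aE tens_sum_left -big_split big_map; apply: eq_bigr => -[c y] _ /=.
have [r0 rr'] := r'P (phi y).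
rewrite hr tens_clear_denominator // addrC; congr (_ + _).
rewrite -scaleNr -hs laurent_ext_scaleE rmorphN -rr'; congr (tens _ x).
by rewrite mulNr [v _ * _ * _]mulrC mulrA divfK // (inj_rmorph_neq0 v_inj).
Qed.

Lemma tensor_image_sub_kernel (u : tensor K (submod I)) :
  (forall x, x \in I -> phi x = 0) ->
  tensor_map idfun phi (tensor_map idfun (submod_incl I) u) = 0.
Proof.
move=> I_ker; have [s ->] := tensor_sumP u.
rewrite !raddf_sum big1_seq // => p _.
by rewrite /= !tensor_mapE I_ker ?tens0 //; apply: valP.
Qed.

End TensorKernel.

(** * Torsion of the kernel modulo [I], and the conclusion *)

Lemma graded_kernel_torsion (k0 k : fieldType) (iota : {rmorphism k0 -> k})
    (q : k) (q_transcendental : ~ algebraicOver iota q)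
    (A B : lmodType (laurent_ring iota q)) (phi : {linear A -> B})
    (I : submodClosed A) (I_ker : forall x, x \in I -> phi x = 0)
    (B_torsionfree : torsionfree B)
    (J : eqType) (Ij Aj : J -> submodClosed A) (Bj : J -> submodClosed B)
    (I_decomposition : direct_decomposition I Ij)
    (A_decomposition : direct_decomposition predT Aj)
    (B_decomposition : direct_decomposition predT Bj)
    (Aj_fg : forall j, finitely_generated (Aj j))
    (Ij_sub_Aj : forall j, {subset Ij j <= Aj j})
    (phi_Aj_Bj : forall j x, x \in Aj j -> phi x \in Bj j)
    (kernel_lift : forall x, phi x = 0 ->
       exists2 a, a \in I & exists p, x - a = (laurent_gen iota q - 1) *: p)
    (x : A) :
  phi x = 0 -> exists2 s : laurent_ring iota q, s != 0 & s *: x \in I.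
Proof.
move=> phix0; set c := _ - 1 in kernel_lift.
have v_inj := @laurent_inj_inj _ _ iota q; set v := laurent_inj _ _ in v_inj.
pose U : set A := fun x => exists2 s : laurent_ring iota q, s != 0 & s *: x \in I.
have satU : saturated_submodule U := saturation_saturated v_inj I.
have IU y : y \in I -> U y by exists 1; rewrite ?oner_neq0 ?scale1r.
have c0 : c != 0 := laurent_gen_sub1_neq0 q_transcendental.
(* The saturation [U] is closed under sums, so homogeneous kernel elements suffice. *)
suff UA j y : y \in Aj j -> phi y = 0 -> U y.
  have [s [f [_ fA phif0 _ ->]]] :=
    kernel_component A_decomposition B_decomposition phi_Aj_Bj phix0.
  change (U (\sum_(j <- s) f j)).
  elim: s => [|j s IH]; first by rewrite big_nil; case: satU.
  by rewrite big_cons; apply: saturatedD => //; apply: (UA j).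
move=> yA phiy0; apply: contrapT => nUy.
have [mu [muZ muy muU mu_frac]] := fraction_functional v_inj satU nUy.
have [d /eqP d0 dP] := fraction_functional_denominator v_inj muZ mu_frac (Aj_fg j).
apply: d0; apply: (laurent_gen_sub1_separated q_transcendental) => m.
have [z [zA _ yzI]] := graded_kernel_iterate I_ker B_torsionfree c0
  I_decomposition A_decomposition B_decomposition Ij_sub_Aj phi_Aj_Bj
  kernel_lift m yA phiy0.
(* As [mu] kills [y - c^m z], one has [1 = mu y = c^m mu z]; multiplying by [d] gives [d = c^m r]
   with [r = d mu z] in [R]. *)
have [r rE] := dP z zA; exists r; apply: v_inj.
have := muU _ (IU _ yzI); rewrite raddfB muZ muy => /eqP; rewrite subr_eq0 => /eqP e.
by rewrite rmorphM -rE mulrCA -[X in _ = _ * X]e mulr1.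
Qed.

Theorem theorem1p3
  (k0 k : fieldType) (iota : {rmorphism k0 -> k}) (q : k)
  (q_notin : forall c : k0, q <> iota c)
  (q_transcendental : ~ algebraicOver iota q)
  (A B : pzAlgType (laurent_ring iota q))
  (phi : {linear A -> B}) (phi_hom : algebra_hom phi)
  (I : submodClosed A) (I_ideal : two_sided_ideal I)
  (I_ker : forall x : A, x \in I -> phi x = 0)
  (B_torsionfree : torsionfree B)
  (J : eqType) (Ij Aj : J -> submodClosed A) (Bj : J -> submodClosed B)
  (I_decomposition : direct_decomposition I Ij)
  (A_decomposition : direct_decomposition predT Aj)
  (B_decomposition : direct_decomposition predT Bj)
  (Aj_fg : forall j : J, finitely_generated (Aj j))
  (Ij_sub_Aj : forall j : J, {subset Ij j <= Aj j})
  (phi_Aj_Bj : forall (j : J) (x : A), x \in Aj j -> phi x \in Bj j)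
  (ker_reduction : forall x : reduction (laurent_gen iota q - 1) A,
     reduction_map phi x = 0 <->
     exists y : reduction (laurent_gen iota q - 1) (submod I),
       x = reduction_map (submod_incl I) y) :
  forall t : tensor (laurent_ext iota q) A,
    tensor_map idfun phi t = 0 <->
    exists u : tensor (laurent_ext iota q) (submod I),
      t = tensor_map idfun (submod_incl I) u.
Proof.
move=> t; split=> [|[u ->]]; last exact: tensor_image_sub_kernel.
apply: tensor_kernel_sub_image => // x.
apply: (graded_kernel_torsion q_transcendental I_ker B_torsionfree
  I_decomposition A_decomposition B_decomposition Aj_fg Ij_sub_Aj phi_Aj_Bj).
by apply: reduction_kernel_lift => y /ker_reduction.
Qed.
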